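(* In Setting B (below), suppose the initial output satisfies $\underline y(0)<y(0)<\overline y(0)$ (equivalently $-\alpha(0)<\varphi_1(0)<\beta(0)$) and $u(0)=0$. Then along the closed-loop solution $$\frac{d}{dt}\mathcal{W}_{n+1}\le -\frac{k_1\zeta^{2r}}{1-\zeta^{2r}}-\sum_{j=2}^{n}k_j\varphi_j^2-k_{n+1}\varrho^2,$$ and $(\varphi_1(t),\dots,\varphi_n(t),\varrho(t))\to0$ as $t\to\infty$; i.e. the closed-loop error dynamics are (semi-globally, for all initial outputs in the constraint set) asymptotically stable.
   Context: Setting B. Let $n\ge2$. Plant: $\dot x_i=f_i(\bar x_i)+g_i(\bar x_i)x_{i+1}$ ($i=1,\dots,n-1$), $\dot x_n=f_n(\bar x_n)+g_n(\bar x_n)u$, $y=x_1$, $\bar x_i=(x_1,\dots,x_i)$, $f_i,g_i:\mathbb{R}^i\to\mathbb{R}$ smooth, with constants $0<\underline g_i\le\bar g_i$ such that $\underline g_i\le|g_i(\bar x_i)|\le\bar g_i$. Input $u$ generated by the saturation model $\dot u=p_1G(u)u_c-p_1p_2u$, $u(0)=0$, with $u_{\min}<0<u_{\max}$, $p_1,p_2>0$, $\gamma$ an even positive integer, $G(u)=\rho(u)[1-(u/u_{\max})^\gamma]+(1-\rho(u))[1-(u/u_{\min})^\gamma]$, $\rho(u)=1$ if $u>0$, $0$ otherwise. Output constraints: continuous $\underline y(t)<\overline y(t)$ with $\underline y,\overline y$ and their derivatives up to order $n+1$ bounded. Reference $y_d$ with derivatives up to order $n+1$ bounded and with $\underline y(t)<y_d(t)<\overline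 y(t)$; set $\alpha(t)=y_d(t)-\underline y(t)$, $\beta(t)=\overline y(t)-y_d(t)$ and assume there are constants $0<\underline\alpha\le\alpha(t)\le\overline\alpha$, $0<\underline\beta\le\beta(t)\le\overline\beta$ for all $t\ge0$. Fix $r\in\mathbb{N}$ with $2r\ge n$, gains $k_1,\dots,k_{n+1}>0$, $\delta>0$. Error coordinates: $\varphi_1=y-y_d$, $\varphi_i=x_i-\eta_{i-1}$ ($i=2,\dots,n$), $\varrho=u-\eta_n$. Let $s=1$ if $\varphi_1>0$ and $s=0$ otherwise; $\zeta=s\varphi_1/\beta+(1-s)\varphi_1/\alpha$; $\digamma=\frac{s}{\beta^{2r}-\varphi_1^{2r}}+\frac{1-s}{\alpha^{2r}-\varphi_1^{2r}}$. Stabilizing functions: $\eta_1=\frac{1}{g_1(x_1)}[\dot y_d-f_1(x_1)-(k_1+\overline k_1(t))\varphi_1]$ with $\overline k_1(t)=\sqrt{(\dot\alpha/\alpha)^2+(\dot\beta/\beta)^2+\delta}$; for $i=2,\dots,n$, $\eta_i=\frac{1}{g_i(\bar x_i)}[\dot\eta_{i-1}-f_i(\bar x_i)-c_i-k_i\varphi_i]$ where $c_2=\digamma g_1(x_1)\varphi_1^{2r-1}$ and $c_i=g_{i-1}(\bar x_{i-1})\varphi_{i-1}$ for $i\ge3$, and $\dot\eta_{i-1}$ is the total time derivative of $\eta_{i-1}$ along the dynamics. Commanded input: $u_c=\frac{p_1p_2u+\dot\eta_n-g_n(\bar x_n)\varphi_n-k_{n+1}\varrho}{p_1G(u)}$.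 Barrier Lyapunov function: $\mathcal{W}_1=\frac{1}{2r}\ln\frac{1}{1-\zeta^{2r}}$ (equivalently $\frac{s}{2r}\ln\frac{\beta^{2r}}{\beta^{2r}-\varphi_1^{2r}}+\frac{1-s}{2r}\ln\frac{\alpha^{2r}}{\alpha^{2r}-\varphi_1^{2r}}$), and $\mathcal{W}_{n+1}=\mathcal{W}_1+\tfrac12\sum_{j=2}^n\varphi_j^2+\tfrac12\varrho^2$.
   Formalization: The closed-loop solution is assumed to exist for all t≥0 with G(u(t))≠0 and every η_i differentiable along it (else u_c is undefined: u can reach a saturation limit, and for 2r=n η_n can have a kink at φ_1=0); asymptotic stability is stated as the W-inequality plus convergence. *)

(* Defs.v *)
From HB Require Import structures.
From mathcomp Require Import all_boot all_order all_algebra.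
From mathcomp Require Import all_classical all_reals all_analysis.
Set Implicit Arguments. Unset Strict Implicit. Unset Printing Implicit Defensive.
Import Order.TTheory GRing.Theory Num.Theory.
Import numFieldNormedType.Exports.
Local Open Scope ring_scope.

Section Defs.
Variable R : realType.

Fixpoint iterD (V : normedModType R) (vs : seq V) (h : V -> R) : V -> R :=
  match vs with
  | [::] => h
  | v :: vs' => fun z => 'D_v (iterD vs' h) z
  end.

Definition smooth (V : normedModType R) (h : V -> R) : Prop :=
  forall vs : seq V,
    continuous (iterD vs h) /\ forall (v z : V), derivable (iterD vs h) z v.

Definition derivs_bounded (m : nat) (h : R -> R) : Prop :=
  (forall (j : nat) (t : R), (j < m)%N -> 0 <= t -> derivable (derive1n j h) t 1) /\
  (forall j : nat, (j <= m)%N -> exists M : R, forall t, 0 <= t -> `|derive1n j h t| <= M).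

(* \bar x_i(t) = (x_1(t), ..., x_i(t)); x is 1-indexed. *)
Definition barx (x : nat -> R -> R) (i : nat) (t : R) : 'rV[R]_i :=
  \row_(j < i) x j.+1 t.

Definition rho_sat (v : R) : R := if 0 < v then 1 else 0.
Definition Gsat (umin umax : R) (gam : nat) (v : R) : R :=
  rho_sat v * (1 - (v / umax) ^+ gam) + (1 - rho_sat v) * (1 - (v / umin) ^+ gam).

Definition s_sw (phi1 : R) : R := if 0 < phi1 then 1 else 0.
Definition zeta (phi1 a b : R) : R :=
  s_sw phi1 * phi1 / b + (1 - s_sw phi1) * phi1 / a.
Definition digamma (r : nat) (phi1 a b : R) : R :=
  s_sw phi1 / (b ^+ (2 * r) - phi1 ^+ (2 * r)) +
  (1 - s_sw phi1) / (a ^+ (2 * r) - phi1 ^+ (2 * r)).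
Definition W1 (r : nat) (phi1 a b : R) : R :=
  (2 * r)%:R^-1 * ln ((1 - zeta phi1 a b ^+ (2 * r))^-1).

End Defs.

(* Main.v *)
(** Along the closed loop every cross term of dW/dt cancels against the next one,
    which leaves the stated bound. Since [ln (1 / (1 - z)) <= z / (1 - z)], that
    bound is itself at most [- c * W] for some [c > 0], so [W] decays exponentially
    and no Barbalat argument is needed. As [W] is nonincreasing while the output
    constraint holds, [zeta ^+ (2 * r)] stays below some [q < 1] up to a first exit
    time, and hence, by continuity, there is no exit time. *)

Require Import Defs.
From HB Require Import structures.
From mathcomp Require Import all_boot all_order all_algebra.
From mathcomp Require Import all_classical all_reals all_analysis.
From mathcomp Require Import ring lra.
Import Order.TTheory GRing.Theory Num.Theory.
Import numFieldNormedType.Exports.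
Local Open Scope classical_set_scope.
Local Open Scope ring_scope.

(** * Truncated powers, exponential comparison and first exit times *)

(** An exponent of at least two flattens the kink of the positive part: at [0] the difference
    quotient is [0] from the left and [h ^+ m.+1] from the right. *)
Lemma is_derive_maxr0X (R : realType) (m : nat) (y : R) :
  is_derive y (1 : R) (fun z : R => Num.max z 0 ^+ m.+2)
    (m.+2%:R * Num.max y 0 ^+ m.+1).
Proof.
have [y0|y0|->] := ltgtP y 0.
- rewrite expr0n mulr0.
  apply: (@near_eq_is_derive R R R (cst 0)).
  near=> z; rewrite max_r ?expr0n//= ltW//; near: z; exact: lt_nbhsl.
- apply: (@near_eq_is_derive R R R ((@id R) ^+ m.+2)).
    near=> z; rewrite exprfctE max_l//= ltW//; near: z; exact: lt_nbhsr.
  apply: is_derive_eq; rewrite /GRing.scale/=; by rewrite mulr1.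
- rewrite expr0n mulr0.
  have cvg0 : h^-1 *: (((fun z : R => Num.max z 0 ^+ m.+2) \o shift 0) (h *: 1)
      - (fun z : R => Num.max z 0 ^+ m.+2) 0) @[h --> (0 : R)^'] --> (0 : R).
    apply/cvgr0Pnorm_lt => e e0; near=> h.
    have h0 : h != 0 by near: h; exact: nbhs_dnbhs_neq.
    have h1 : `|h| < Num.min e 1.
      near: h; apply: (@dnbhs0_lt _ R).
      by rewrite lt_min e0/=.
    rewrite /shift/= /GRing.scale/= mulr1 addr0 maxxx expr0n subr0.
    move: h1; rewrite lt_min => /andP[he h1].
    have [hn|hp|/eqP] := ltgtP h 0; last by rewrite (negbTE h0).
      by rewrite expr0n mulr0 normr0.
    rewrite exprS mulrA mulVf// mul1r normrX exprS (le_lt_trans _ he)//.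
    by rewrite ler_piMr// exprn_ile1// ltW.
  apply: DeriveDef; first by apply/cvg_ex; exists 0.
  exact/cvg_lim.
Unshelve. all: by end_near. Qed.

(** Gronwall comparison by an integrating factor: [W s * expR (c * s)] has nonpositive
    derivative. *)
Lemma exp_decay (R : realType) (W dW : R -> R) (c t : R) : 0 <= t ->
    (forall s, 0 <= s <= t -> is_derive s 1 W (dW s) /\ dW s <= - c * W s) ->
  W t <= W 0 * expR (- (c * t)).
Proof.
move=> t0 dWle.
pose F s := W s * expR (c * s).
have dF s : 0 <= s <= t ->
    is_derive s 1 F ((dW s + c * W s) * expR (c * s)).
  move=> /dWle[dWs _].
  have de : is_derive s 1 (fun s => expR (c * s)) (expR (c * s) * c).
    have dc : is_derive s (1 : R) (fun s : R => c * s) c.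
      apply: (@is_derive_eq _ _ _ (c \*: (@id R))); by rewrite /GRing.scale/= mulr1.
    exact: (is_derive1_comp (is_derive_expR _) dc).
  apply: (@is_derive_eq _ _ _ (W * (fun s => expR (c * s)))).
  by rewrite /GRing.scale/=; ring.
have FF : F t <= F 0.
  apply: (@ler0_derive1_nincr _ F 0 t) => //.
  - move=> s /[!in_itv]/= /andP[s0 st].
    have ds : 0 <= s <= t by rewrite !ltW.
    exact: (@ex_derive _ _ _ _ _ _ _ (dF s ds)).
  - move=> s /[!in_itv]/= /andP[s0 st].
    have ds : 0 <= s <= t by rewrite !ltW.
    rewrite derive1E (@derive_val _ _ _ _ _ _ _ (dF s ds)).
    have [_ h] := dWle s ds.
    by rewrite mulr_le0_ge0 ?expR_ge0//; lra.
  - apply: derivable_within_continuous => s /[!in_itv]/= ds.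
    exact: (@ex_derive _ _ _ _ _ _ _ (dF s ds)).
by rewrite expRN -ler_pdivrMr ?invr_gt0 ?expR_gt0// invrK (le_trans FF)// /F mulr0 expR0 mulr1.
Qed.

(* At a first exit time [q] would still bound [Z] by continuity. *)
Lemma barrier_invariance (R : realType) (Z : R -> R) (q : R) : q < 1 ->
    (forall t, 0 <= t -> {for t, continuous Z}) ->
    (forall t, 0 <= t -> (forall s, 0 <= s <= t -> Z s < 1) -> Z t <= q) ->
    Z 0 < 1 ->
  forall t, 0 <= t -> Z t < 1.
Proof.
move=> q1 Zc Zq Z0 t1 t1_ge0; rewrite ltNge; apply/negP => Zt1.
pose S := [set t : R | 0 <= t /\ 1 <= Z t].
have infS : has_inf S by split; [exists t1 | exists 0 => t []].
set T := inf S.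
have T0 : 0 <= T by apply: lb_le_inf; [exists t1 | move=> t []].
(* The infimum is attained: otherwise [Z < 1] on a ball around [T], yet [S] has points there. *)
have ZT1 : 1 <= Z T.
  rewrite leNgt; apply/negP => ZT.
  have /nbhs_ballP[e /= e0 be] : \forall s \near T, Z s < 1.
    by have /cvgr_lt := Zc T T0; apply.
  have [s [s0 Zs] sTe] := inf_adherent e0 infS.
  have Ts : T <= s by apply: ge_inf => //; exact: infS.2.
  have : Z s < 1 by apply: be; rewrite /ball/= ltr_distlC; apply/andP; split; lra.
  by rewrite ltNge Zs.
have TP : 0 < T.
  by rewrite lt_neqAle T0 andbT; apply/eqP => TE; move: ZT1; rewrite -TE leNgt Z0.
have below s : 0 <= s -> s < T -> Z s < 1.
  move=> s0; apply: contraTT; rewrite -!leNgt => Zs.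
  by apply: ge_inf => //; exact: infS.2.
have : Z T <= q.
  rewrite leNgt; apply/negP => qZT.
  have /nbhs_ballP[e /= e0 be] : \forall s \near T, q < Z s.
    by have /cvgr_gt := Zc T T0; apply.
  (* A time just before [T], clipped at [0]; the constraint holds on all of [[0, s]], so [Zq]
     applies and contradicts [q < Z s]. *)
  pose s := Num.max 0 (T - e / 2).
  have s0 : 0 <= s by rewrite le_max lexx.
  have sT : s < T by rewrite gt_max TP/=; lra.
  have sTe : T - e / 2 <= s by rewrite le_max lexx orbT.
  have : q < Z s by apply: be; rewrite /ball/= ltr_distl; apply/andP; split; lra.
  rewrite ltNge Zq// => s' /andP[s'0 s's]; apply: below => //.
  exact: le_lt_trans sT.
by move=> /le_lt_trans/(_ q1); rewrite ltNge ZT1.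
Qed.

(** * Algebra and differentiation of even powers of [zeta] *)

Lemma zetaE (R : realType) (p a b : R) :
  zeta p a b = p / (if 0 < p then b else a).
Proof.
by rewrite /zeta /s_sw; case: ifPn => _;
rewrite !(subrr, subr0, mul1r, mul0r, addr0, add0r).
Qed.

(* Splitting into positive and negative parts makes differentiability visible at
   [p = 0], where [zeta] switches denominators. *)
Lemma zetaX_maxr (R : realType) (p a b : R) (m : nat) : (0 < m)%N -> ~~ odd m ->
  zeta p a b ^+ m = Num.max p 0 ^+ m / b ^+ m + Num.max (- p) 0 ^+ m / a ^+ m.
Proof.
move=> m0 em; rewrite zetaE; have [p0|p0] := ltP 0 p.
  by rewrite (max_r (_ : - p <= 0)) ?oppr_le0 ?ltW// expr0n gtn_eqF// mul0r addr0 expr_div_n.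
rewrite expr0n gtn_eqF// mul0r add0r (max_l (_ : 0 <= - p)) ?oppr_ge0//.
by rewrite exprNn -signr_odd (negbTE em) expr0 mul1r expr_div_n.
Qed.

Lemma zetaX_ge0 (R : realType) (p a b : R) (m : nat) : ~~ odd m ->
  0 <= zeta p a b ^+ m.
Proof. exact: exprn_even_ge0. Qed.

(** Evenness reduces the claim to a norm below [1]. The sign of [p] selects the barrier that binds;
    the other inequality then holds by sign alone. *)
Lemma zetaX_lt1 (R : realType) (p a b : R) (m : nat) : (0 < m)%N -> ~~ odd m ->
  0 < a -> 0 < b -> (zeta p a b ^+ m < 1) = (- a < p < b).
Proof.
move=> m0 em a0 b0; rewrite zetaE -(normr_idP (exprn_even_ge0 _ em)) normrX.
rewrite expr_lt1// normrM normfV; have [p0|p0] := ltP 0 p.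
  rewrite !gtr0_norm// ltr_pdivrMr// mul1r.
  by rewrite [- a < p](_ : _ = true)// (lt_trans _ p0)// oppr_lt0.
rewrite (gtr0_norm a0) ler0_norm// ltr_pdivrMr// mul1r ltrNl.
by rewrite (le_lt_trans p0 b0) andbT.
Qed.

(** Each branch is the quotient rule with the active barrier. The branches agree at [p t = 0],
    because [zeta ^+ m.+1] vanishes there. *)
Lemma is_derive_zetaX (R : realType) (m : nat) (p a b : R -> R) (t p' a' b' : R) :
    ~~ odd m -> a t != 0 -> b t != 0 ->
    is_derive t 1 p p' -> is_derive t 1 a a' -> is_derive t 1 b b' ->
  is_derive t 1 (fun s => zeta (p s) (a s) (b s) ^+ m.+2)
    (m.+2%:R * zeta (p t) (a t) (b t) ^+ m.+1 *
     (if 0 < p t then (p' - p t * b' / b t) / b t else (p' - p t * a' / a t) / a t)).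
Proof.
move=> em a0 b0 dp da db.
have dP : is_derive t 1 (fun s => Num.max (p s) 0 ^+ m.+2)
    (m.+2%:R * Num.max (p t) 0 ^+ m.+1 * p').
  exact: (is_derive1_comp (is_derive_maxr0X _ m (p t)) dp).
have dN : is_derive t 1 (fun s => Num.max (- p s) 0 ^+ m.+2)
    (m.+2%:R * Num.max (- p t) 0 ^+ m.+1 * - p').
  have dNp : is_derive t 1 (fun s => - p s) (- p') by exact: is_deriveN.
  exact: (@is_derive1_comp _ _ (fun s => - p s) _ _ _ (is_derive_maxr0X _ m (- p t)) dNp).
have dV (c : R -> R) c' : c t != 0 -> is_derive t 1 c c' ->
    is_derive t 1 (fun s => (c s ^+ m.+2)^-1) (- (m.+2%:R * c' / c t ^+ m.+3)).
  move=> c0 dc.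
  have dX : is_derive t 1 (fun s => c s ^+ m.+2) ((m.+2%:R * c t ^+ m.+1) *: c').
    by rewrite -exprfctE; exact: is_deriveX.
  have dI := @is_deriveV _ (fun s => c s ^+ m.+2) _ _ _ (expf_neq0 m.+2 c0) dX.
  apply: is_derive_eq.
  rewrite /GRing.scale/= !exprS; field.
  by rewrite c0 expf_neq0.
have -> : (fun s => zeta (p s) (a s) (b s) ^+ m.+2) =
    (fun s => Num.max (p s) 0 ^+ m.+2) * (fun s => (b s ^+ m.+2)^-1) +
    (fun s => Num.max (- p s) 0 ^+ m.+2) * (fun s => (a s ^+ m.+2)^-1).
  by apply/funext => s; rewrite zetaX_maxr//= negbK.
have dPN := is_deriveD (is_deriveM dP (dV _ _ b0 db)) (is_deriveM dN (dV _ _ a0 da)).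
apply: (@is_derive_eq _ _ _ _ _ _ _ _ dPN).
rewrite /GRing.scale/= zetaE; have [p0|p0] := ltP 0 (p t).
  rewrite (max_r (_ : - p t <= 0)) ?oppr_le0 ?ltW// !expr0n/= expr_div_n !exprS.
  by field; rewrite a0 b0 !expf_neq0.
rewrite (max_l (_ : 0 <= - p t)) ?oppr_ge0// !expr0n/= expr_div_n.
(* As [m] is even, [(- p t) ^+ m.+1] yields a sign that cancels the one in front of [p']. *)
rewrite ![(- p t) ^+ _]exprNn -(signr_odd _ m.+1) -(signr_odd _ m.+2)/= negbK (negbTE em).
rewrite !exprS expr0.
by field; rewrite a0 b0 !expf_neq0.
Qed.

(** * Estimates for the logarithmic barrier *)

(** This is [ln (1 + y) <= y] at [y = z / (1 - z)]. *)
Lemma ln_invB1_le (R : realType) (z : R) : z < 1 -> ln (1 - z)^-1 <= z / (1 - z).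
Proof.
move=> z1; have z0 : 0 < 1 - z by rewrite subr_gt0.
have -> : ln (1 - z)^-1 = ln (1 + z / (1 - z)).
  by congr ln; field; rewrite gt_eqF.
apply: le_ln1Dx; rewrite ltr_pdivlMr//; lra.
Qed.

(** The same inequality at [y = - z]; it converts a bound on [W1] into one on [zeta ^+ (2 * r)]. *)
Lemma ln_invB1_ge (R : realType) (z : R) : z < 1 -> z <= ln (1 - z)^-1.
Proof.
move=> z1; have z0 : 0 < 1 - z by rewrite subr_gt0.
rewrite lnV ?posrE// lerNr; apply: le_ln1Dx; lra.
Qed.

(** Dividing through by the active barrier to the power [2 * r] turns the coupling term of [eta 2]
    into the factor produced by differentiating [W1]. *)
Lemma digammaE (R : realType) (r : nat) (p a b : R) : (0 < r)%N ->
    0 < a -> 0 < b -> zeta p a b ^+ (2 * r) < 1 ->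
  digamma r p a b * p ^+ (2 * r).-1 =
  zeta p a b ^+ (2 * r).-1 / (1 - zeta p a b ^+ (2 * r))
    / (if 0 < p then b else a).
Proof.
move=> r0 a0 b0; rewrite zetaE => z1.
have -> : digamma r p a b =
    ((if 0 < p then b else a) ^+ (2 * r) - p ^+ (2 * r))^-1.
  rewrite /digamma /s_sw; case: ifPn => _;
  by rewrite !(subrr, subr0, mul1r, mul0r, addr0, add0r).
have d0 : 0 < (if 0 < p then b else a) by case: ifP.
move: (if 0 < p then b else a) d0 z1 => d d0 z1.
have [m mE] : exists m, (2 * r)%N = m.+1 by exists (2 * r).-1; rewrite prednK// muln_gt0.
rewrite mE/= in z1 *.
have : d ^+ m.+1 - p ^+ m.+1 != 0.
  rewrite gt_eqF// subr_gt0; move: z1; rewrite expr_div_n ltr_pdivrMr ?exprn_gt0//.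
  by rewrite mul1r.
have : d ^+ m != 0 by rewrite expf_neq0// gt_eqF.
rewrite !expr_div_n !exprS => dm0 dp0.
by field; rewrite dm0 dp0 gt_eqF.
Qed.

(* [kb] dominates [-a'/a] and [-b'/b], which absorbs the drift of the moving barriers. *)
Lemma derive_W1_le (R : realType) (r : nat) (p a b : R -> R)
    (t p' a' b' k1 delta v : R) :
  let z := zeta (p t) (a t) (b t) ^+ (2 * r) in
  let kb : R := Num.sqrt ((a' / a t) ^+ 2 + (b' / b t) ^+ 2 + delta) in
    (0 < r)%N -> 0 < a t -> 0 < b t -> 0 <= delta -> z < 1 ->
    is_derive t 1 p p' -> is_derive t 1 a a' -> is_derive t 1 b b' ->
    p' = v - (k1 + kb) * p t ->
  exists2 dW, is_derive t 1 (fun s => W1 r (p s) (a s) (b s)) dW &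
    dW <= - (k1 * z / (1 - z)) + digamma r (p t) (a t) (b t) * p t ^+ (2 * r).-1 * v.
Proof.
move=> z kb r0 a0 b0 delta0 z1 dp da db p'E.
rewrite digammaE// -/z.
have [m mE] : exists m, (2 * r)%N = m.+2.
  by exists (2 * r).-2; case: r r0 {z z1} => // r _; rewrite mulnS.
have em : ~~ odd m by have := oddM 2 r; rewrite mE/= negbK => ->.
have := is_derive_zetaX _ m _ _ _ _ _ _ _ em (lt0r_neq0 a0) (lt0r_neq0 b0) dp da db.
rewrite -mE.
set dz := (X in is_derive _ _ _ X) => dZ.
have z0 : 0 < 1 - z by rewrite subr_gt0.
have dOmZ : is_derive t 1 (fun s => 1 - zeta (p s) (a s) (b s) ^+ (2 * r)) (- dz).
  have := is_deriveB (is_derive_cst (1 : R) t (1 : R)) dZ.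
  by rewrite sub0r.
have dI : is_derive t 1 (fun s => (1 - zeta (p s) (a s) (b s) ^+ (2 * r))^-1)
    (dz / (1 - z) ^+ 2).
  have dI := @is_deriveV _ (fun s => 1 - zeta (p s) (a s) (b s) ^+ (2 * r)) _ _ _
    (lt0r_neq0 z0) dOmZ.
  apply: (@is_derive_eq _ _ _ _ _ _ _ _ dI).
  by rewrite /GRing.scale/= mulrNN mulrC.
have zV0 : 0 < (1 - z)^-1 by rewrite invr_gt0.
have dL := @is_derive1_comp _ _ (fun s => (1 - zeta (p s) (a s) (b s) ^+ (2 * r))^-1)
  _ _ _ (is_derive1_ln zV0) dI.
exists ((2 * r)%:R^-1 * (dz / (1 - z))).
  apply: (@is_derive_eq _ _ _ _ _ _ _ _ (is_deriveZ (2 * r)%:R^-1 dL)).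
  by rewrite /GRing.scale/= -/z; congr (_ * _); field; rewrite gt_eqF.
have kba : - (a' / a t) <= kb /\ - (b' / b t) <= kb.
  have H (y w : R) : 0 <= w -> - y <= Num.sqrt (y ^+ 2 + w).
    move=> w0; rewrite (le_trans (ler_norm _))// normrN -sqrtr_sqr ler_wsqrtr//.
    by rewrite lerDl.
  split; rewrite /kb; first by rewrite -addrA H// addr_ge0// sqr_ge0.
  by rewrite addrAC addrC H// addr_ge0// sqr_ge0.
(* [d'] is the logarithmic derivative of the active barrier. The inequality to come discards exactly
   the term [(kb + d') * z / (1 - z)], which is nonnegative. *)
have [d' dd' dzE] : exists2 d', - d' <= kb &
    dz = (2 * r)%:R * (zeta (p t) (a t) (b t) ^+ m.+1
      / (if 0 < p t then b t else a t) * v - (k1 + kb + d') * z).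
  rewrite /dz /z mE (exprS _ m.+1) p'E zetaE.
  rewrite -mulrA; have [_|_] := ltP 0 (p t); [exists (b' / b t) | exists (a' / a t)];
    by [case: kba | congr (_ * _); move: (_ ^+ m.+1) => X; field; rewrite gt_eqF].
have r1 : (2 * r)%:R != 0 :> R by rewrite pnatr_eq0 mE.
rewrite dzE -[_ / (1 - z)]mulrA mulKf// mE/= -subr_ge0.
have kz : 0 <= (kb + d') * z / (1 - z).
  apply: divr_ge0 (ltW z0); apply: mulr_ge0; first by lra.
  by rewrite /z mE zetaX_ge0//= negbK.
apply: le_trans kz _; rewrite le_eqVlt; apply/orP; left; apply/eqP.
by field; rewrite gt_eqF//=; case: ifP; rewrite gt_eqF.
Qed.

(** * Convergence from decaying powers, and finite families *)

(** Comparing [m]-th powers avoids roots. If [e <= |h t|], then [e ^+ m * expR (c * t) <= C], which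
    [c * t < expR (c * t)] excludes once [t >= C / (e ^+ m * c)]. *)
Lemma cvg0_expX (R : realType) (m : nat) (c C : R) (h : R -> R) : (0 < m)%N ->
    0 < c -> (forall t, 0 <= t -> `|h t| ^+ m <= C * expR (- (c * t))) ->
  h t @[t --> +oo] --> 0.
Proof.
move=> m0 c0 hC; apply/cvgr0Pnorm_lt => e e0; near=> t.
have t0 : 0 <= t by near: t; exact: nbhs_pinfty_ge.
have em0 : 0 < e ^+ m by rewrite exprn_gt0.
rewrite ltNge; apply/negP => eh.
have : e ^+ m <= `|h t| ^+ m by apply: lerXn2r; rewrite ?nnegrE// ltW.
move=> /le_trans/(_ (hC _ t0)); apply/negP; rewrite -ltNge.
rewrite expRN ltr_pdivrMr ?expR_gt0//.
have Ct : C / (e ^+ m * c) <= t by near: t; apply: nbhs_pinfty_ge; exact: num_real.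
apply: (@le_lt_trans _ _ (e ^+ m * (c * t))).
  by move: Ct; rewrite ler_pdivrMr ?mulr_gt0// [t * _]mulrC mulrA.
by rewrite ltr_pM2l// (lt_le_trans _ (expR_ge1Dx _))// ltrDr.
Unshelve. all: by end_near. Qed.

Lemma exists_pos_lb (R : realType) (k : nat -> R) (m : nat) :
    (forall i, (1 <= i <= m)%N -> 0 < k i) ->
  exists2 c, 0 < c & forall i, (1 <= i <= m)%N -> c <= k i.
Proof.
elim: m => [|m IH] kpos.
  by exists 1 => // i /andP[/leq_trans h /h].
have [|c c0 ck] := IH; first by move=> i /andP[i1 im]; rewrite kpos// i1 ltnW.
exists (Num.min c (k m.+1)); first by rewrite lt_min c0 kpos/=.
move=> i /andP[i1]; rewrite leq_eqVlt => /predU1P[->|im].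
  by rewrite ge_min lexx orbT.
by rewrite ge_min ck// i1.
Qed.

Lemma is_derive_sum_nat (R : realType) (h : nat -> R -> R) (dh : nat -> R)
    (m n : nat) (t : R) :
    (forall i, (m <= i < n)%N -> is_derive t 1 (h i) (dh i)) ->
  is_derive t 1 (fun s => \sum_(m <= i < n) h i s) (\sum_(m <= i < n) dh i).
Proof.
elim: n => [|n IH] dhi.
  rewrite big_geq//; under eq_fun do rewrite big_geq//; exact: is_derive_cst.
have [nm|mn] := ltnP n m.
  rewrite big_geq//; under eq_fun do rewrite big_geq//; exact: is_derive_cst.
rewrite big_nat_recr//=; under eq_fun do rewrite big_nat_recr//=.
apply: is_deriveD; last by apply: dhi; rewrite mn/=.
by apply: IH => i /andP[mi /ltnW ni]; apply: dhi; rewrite mi.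
Qed.

Theorem theorem4 (R : realType) (n r : nat)
  (f g : forall i : nat, 'rV[R]_i -> R) (gl gu : nat -> R)
  (umin umax p1 p2 : R) (gam : nat)
  (ylo yup yd : R -> R) (alo ahi blo bhi : R)
  (k : nat -> R) (delta : R)
  (x : nat -> R -> R) (u : R -> R) (eta : nat -> R -> R) :
  let alpha := fun t => yd t - ylo t in
  let beta := fun t => yup t - yd t in
  let phi1 := fun t => x 1%N t - yd t in
  let phi := fun (i : nat) t => x i t - eta i.-1 t in
  let varrho := fun t => u t - eta n t in
  let kbar1 := fun t => Num.sqrt ((derive1 alpha t / alpha t) ^+ 2
                                  + (derive1 beta t / beta t) ^+ 2 + delta) in
  let c := fun (i : nat) t =>
    if i == 2%N then digamma r (phi1 t) (alpha t) (beta t)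
                     * g 1%N (barx x 1 t) * phi1 t ^+ (2 * r).-1
    else g i.-1 (barx x i.-1 t) * phi i.-1 t in
  let uc := fun t =>
    (p1 * p2 * u t + derive1 (eta n) t - g n (barx x n t) * phi n t - k n.+1 * varrho t)
    / (p1 * Gsat umin umax gam (u t)) in
  let W := fun t => W1 r (phi1 t) (alpha t) (beta t)
           + 2^-1 * \sum_(2 <= j < n.+1) phi j t ^+ 2 + 2^-1 * varrho t ^+ 2 in
  (* ---- Setting B: plant ---- *)
  (2 <= n)%N ->
  (forall i, (1 <= i <= n)%N -> smooth (f i) /\ smooth (g i)) ->
  (forall i, (1 <= i <= n)%N ->
     0 < gl i /\ gl i <= gu i /\ forall z, gl i <= `|g i z| <= gu i) ->
  (* ---- saturation model ---- *)
  umin < 0 -> 0 < umax -> 0 < p1 -> 0 < p2 -> (0 < gam)%N -> ~~ odd gam ->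
  (* ---- output constraints and reference ---- *)
  (forall t, 0 <= t -> {for t, continuous ylo} /\ {for t, continuous yup}) ->
  (forall t, 0 <= t -> ylo t < yup t) ->
  derivs_bounded n.+1 ylo -> derivs_bounded n.+1 yup -> derivs_bounded n.+1 yd ->
  (forall t, 0 <= t -> ylo t < yd t < yup t) ->
  0 < alo -> 0 < blo ->
  (forall t, 0 <= t -> alo <= alpha t <= ahi /\ blo <= beta t <= bhi) ->
  (* ---- design parameters ---- *)
  (n <= 2 * r)%N ->
  (forall i, (1 <= i <= n.+1)%N -> 0 < k i) -> 0 < delta ->
  (* ---- closed-loop solution on t >= 0 ---- *)
  (forall t, 0 <= t -> forall i, (1 <= i <= n)%N -> derivable (x i) t 1) ->
  (forall t, 0 <= t -> derivable u t 1) ->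
  (forall t, 0 <= t -> forall i, (1 <= i < n)%N ->
     derive1 (x i) t = f i (barx x i t) + g i (barx x i t) * x i.+1 t) ->
  (forall t, 0 <= t -> derive1 (x n) t = f n (barx x n t) + g n (barx x n t) * u t) ->
  (forall t, 0 <= t ->
     derive1 u t = p1 * Gsat umin umax gam (u t) * uc t - p1 * p2 * u t) ->
  (* stabilizing functions, with dot eta_{i-1} the time derivative along the solution *)
  (forall t, 0 <= t ->
     eta 1%N t = (g 1%N (barx x 1 t))^-1
                 * (derive1 yd t - f 1%N (barx x 1 t) - (k 1%N + kbar1 t) * phi1 t)) ->
  (forall t, 0 <= t -> forall i, (2 <= i <= n)%N ->
     eta i t = (g i (barx x i t))^-1
               * (derive1 (eta i.-1) t - f i (barx x i t) - c i t - k i * phi i t)) ->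
  (forall t, 0 <= t -> forall i, (1 <= i <= n)%N -> derivable (eta i) t 1) ->
  (forall t, 0 <= t -> Gsat umin umax gam (u t) != 0) ->
  (* ---- initial conditions ---- *)
  ylo 0 < x 1%N 0 < yup 0 ->
  u 0 = 0 ->
  (* ---- conclusions ---- *)
  (forall t, 0 <= t ->
     - alpha t < phi1 t < beta t /\
     derivable W t 1 /\
     derive1 W t <= - (k 1%N * zeta (phi1 t) (alpha t) (beta t) ^+ (2 * r)
                    / (1 - zeta (phi1 t) (alpha t) (beta t) ^+ (2 * r)))
                - \sum_(2 <= j < n.+1) k j * phi j t ^+ 2
                - k n.+1 * varrho t ^+ 2) /\
  (phi1 t @[t --> +oo] --> 0) /\
  (forall i, (2 <= i <= n)%N -> phi i t @[t --> +oo] --> 0) /\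
  (varrho t @[t --> +oo] --> 0).
Proof.
move=> alpha beta phi1 phi varrho kbar1 c uc W n2 _ gb _ _ p1_gt0 _ _ _ _ _.
move=> dylo dyup dyd _ alo0 blo0 ab_bd nr kpos delta0 dx du x_ode xn_ode u_ode.
move=> eta1E etaE deta G0 y0 u0.
have r0 : (0 < r)%N by case: (r) nr => //; rewrite muln0 leqNgt (leq_trans _ n2).
have even2r : ~~ odd (2 * r) by rewrite oddM.
have r2_gt0 : (0 < 2 * r)%N by rewrite muln_gt0.
have al_gt0 (t : R) : 0 <= t -> 0 < alpha t.
  by move=> /ab_bd[/andP[+ _] _]; exact: lt_le_trans.
have be_gt0 (t : R) : 0 <= t -> 0 < beta t.
  by move=> /ab_bd[_ /andP[+ _]]; exact: lt_le_trans.
have g_neq0 i t : (1 <= i <= n)%N -> g i (barx x i t) != 0.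
  move=> /gb[gl0 [_ /(_ (barx x i t))/andP[+ _]]].
  by rewrite -normr_gt0; exact: lt_le_trans.
have is_der (h : R -> R) t : derivable h t 1 -> is_derive t 1 h (derive1 h t).
  by rewrite derive1E => /derivableP.
have der0 h (t : R) : derivs_bounded n.+1 h -> 0 <= t -> derivable h t 1.
  by case=> + _ t0 => /(_ 0%N t isT t0).
have dal (t : R) (t0 : 0 <= t) : is_derive t 1 alpha (derive1 alpha t).
  by apply: is_der; apply: derivableB; exact: der0.
have dbe (t : R) (t0 : 0 <= t) : is_derive t 1 beta (derive1 beta t).
  by apply: is_der; apply: derivableB; exact: der0.
(* With [phi_(n+1) := varrho], the cross terms are [A j - A j.-1] and telescope. *)
pose Phi i := if (i <= n)%N then phi i else varrho.
pose A i t := if i == 1%N then digamma r (phi1 t) (alpha t) (beta t)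
                * phi1 t ^+ (2 * r).-1 * (g 1%N (barx x 1 t) * phi 2%N t)
              else g i (barx x i t) * phi i t * Phi i.+1 t.
pose Z t := zeta (phi1 t) (alpha t) (beta t) ^+ (2 * r).

(* Closed-loop error dynamics *)
have dphi1 (t : R) (t0 : 0 <= t) : is_derive t 1 phi1
    (g 1%N (barx x 1 t) * phi 2%N t - (k 1%N + kbar1 t) * phi1 t).
  have dx1 := is_der _ _ (dx t t0 1%N (ltnW n2)).
  apply: (@is_derive_eq _ _ _ _ _ _ _ _ (is_deriveB dx1 (is_der _ _ (der0 _ _ dyd t0)))).
  (* Writing [x 2] as [phi 2 + eta 1] lets the choice of [eta 1] remove [f 1] and the reference
     derivative. *)
  rewrite x_ode//= /phi/= eta1E//.
  have g1_neq0 : g 1%N (barx x 1 t) != 0 by apply: g_neq0; exact: ltnW.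
  by field.
have dphi (t : R) (t0 : 0 <= t) i (i2n : (2 <= i <= n)%N) : is_derive t 1 (phi i)
    (g i (barx x i t) * Phi i.+1 t - c i t - k i * phi i t).
  have /andP[i2 ni] := i2n.
  have i1n : (1 <= i <= n)%N by rewrite ltnW.
  have i'n : (1 <= i.-1 <= n)%N by rewrite -ltnS prednK ?(ltnW i2)// i2 (leq_trans (leq_pred i)).
  have dxi := is_der _ _ (dx t t0 i i1n).
  have dei := is_der _ _ (deta t t0 i.-1 i'n).
  apply: (@is_derive_eq _ _ _ _ _ _ _ _ (is_deriveB dxi dei)).
  have gi : g i (barx x i t) * eta i t =
      derive1 (eta i.-1) t - f i (barx x i t) - c i t - k i * phi i t.
    by rewrite etaE// mulVKf// g_neq0.
  (* [Phi i.+1 + eta i] is the next state for [i < n] and the input [u] for [i = n]. *)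
  have -> : derive1 (x i) t = f i (barx x i t) + g i (barx x i t) * (Phi i.+1 t + eta i t).
    rewrite /Phi; case: ltnP => [ltin|nlei].
      by rewrite x_ode ?(ltnW i2)//= /phi/= subrK.
    have -> : i = n by apply/eqP; rewrite eqn_leq ni.
    by rewrite xn_ode// /varrho subrK.
  by rewrite mulrDr gi; ring.
have drho (t : R) (t0 : 0 <= t) : is_derive t 1 varrho
    (- (g n (barx x n t) * phi n t) - k n.+1 * varrho t).
  have nn : (1 <= n <= n)%N by rewrite ltnW//=.
  apply: (@is_derive_eq _ _ _ _ _ _ _ _
    (is_deriveB (is_der _ _ (du t t0)) (is_der _ _ (deta t t0 n nn)))).
  (* The division by [p1 * Gsat] in [uc] inverts the saturation model exactly, since [p1] and [Gsat]
     are nonzero. *)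
  rewrite u_ode// /uc.
  by field; rewrite G0// gt_eqF.

(* Dissipation inequality for [W] *)
pose D t := - (k 1%N * Z t / (1 - Z t)) - \sum_(2 <= j < n.+1) k j * phi j t ^+ 2
              - k n.+1 * varrho t ^+ 2.
have dW (t : R) : 0 <= t -> Z t < 1 -> exists2 w, is_derive t 1 W w & w <= D t.
  move=> t0 Zt.
  have [w1 dW1 w1_le] := derive_W1_le _ r _ _ _ t _ _ _ (k 1%N) delta _
    r0 (al_gt0 t t0) (be_gt0 t t0) (ltW delta0) Zt (dphi1 t t0) (dal t t0) (dbe t t0) erefl.
  have dS : is_derive t 1 (fun t => \sum_(2 <= j < n.+1) phi j t ^+ 2)
      (\sum_(2 <= j < n.+1) 2 * phi j t *
         (g j (barx x j t) * Phi j.+1 t - c j t - k j * phi j t)).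
    apply: is_derive_sum_nat => j j2n.
    have dX := is_deriveX 2 (dphi t t0 j j2n); apply: (@is_derive_eq _ _ _ _ _ _ _ _ dX).
    by rewrite /GRing.scale/= expr1.
  have dR : is_derive t 1 (fun t => varrho t ^+ 2)
      (2 * varrho t * (- (g n (barx x n t) * phi n t) - k n.+1 * varrho t)).
    have dX := is_deriveX 2 (drho t t0); apply: (@is_derive_eq _ _ _ _ _ _ _ _ dX).
    by rewrite /GRing.scale/= expr1.
  have dWt := is_deriveD (is_deriveD dW1 (is_deriveZ 2^-1 dS)) (is_deriveZ 2^-1 dR).
  eexists; first exact: dWt.
  have telescope : \sum_(2 <= j < n.+1) (A j t - A j.-1 t) = A n t - A 1%N t.
    by rewrite big_add1/= telescope_sumr// ltnW.
  have SE : 2^-1 * (\sum_(2 <= j < n.+1) 2 * phi j t *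
         (g j (barx x j t) * Phi j.+1 t - c j t - k j * phi j t)) =
      A n t - A 1%N t - \sum_(2 <= j < n.+1) k j * phi j t ^+ 2.
    rewrite -telescope -sumrB mulr_sumr; apply: eq_big_nat => j /andP[j2 jn].
    have j1 : (j == 1%N) = false by rewrite gtn_eqF.
    (* For [j = 2] this is the [digamma] branch of [c]; for [j >= 3] the bound [j <= n] makes
       [Phi j] equal to [phi j]. *)
    have -> : A j.-1 t = c j t * phi j t.
      rewrite /A /c; case: (j) j2 jn => [|[|[|i]]]//= _ jn; first by ring.
      by rewrite /Phi ifT.
    rewrite /A j1; by field.
  have AnE : A n t = g n (barx x n t) * phi n t * varrho t.
    by rewrite /A gtn_eqF// /Phi ltnn.
  have A1E : A 1%N t = digamma r (phi1 t) (alpha t) (beta t)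
    * phi1 t ^+ (2 * r).-1 * (g 1%N (barx x 1 t) * phi 2%N t) by [].
  (* The two ends of the telescope cancel: [A 1] against the last term of [w1_le], and [A n] against
     the coupling in the derivative of [varrho]. *)
  rewrite /GRing.scale/= SE AnE A1E /D; move: w1_le; rewrite -/(Z t) => w1_le.
  lra.

(* Exponential decay of [W] and invariance of the output constraint *)
have [c0 c0_gt0 c0_le] := exists_pos_lb _ k n.+1 kpos.
have W1E t : W1 r (phi1 t) (alpha t) (beta t) = (2 * r)%:R^-1 * ln (1 - Z t)^-1 by [].
have Z_ge0 t : 0 <= Z t by exact: zetaX_ge0.
have W1_ge t : Z t < 1 -> Z t <= (2 * r)%:R * W1 r (phi1 t) (alpha t) (beta t).
  by move=> Z1; rewrite W1E mulVKf ?ln_invB1_ge// pnatr_eq0 -lt0n.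
have W1_ge0 t : Z t < 1 -> 0 <= W1 r (phi1 t) (alpha t) (beta t).
  move=> Z1; rewrite -(@pmulr_rge0 _ (2 * r)%:R) ?ltr0n//.
  exact: le_trans (W1_ge _ Z1).
have sum_ge0 t : 0 <= \sum_(2 <= j < n.+1) phi j t ^+ 2.
  by rewrite sumr_ge0// => i _; exact: sqr_ge0.
have D_le t : Z t < 1 -> D t <= - c0 * W t.
  move=> Z1; rewrite /D /W.
  have W1_le : c0 * W1 r (phi1 t) (alpha t) (beta t) <= k 1%N * Z t / (1 - Z t).
    (* Factor by factor: [c0 <= k 1], and the prefactor of [W1] is at most [1]. *)
    rewrite -mulrA; apply: ler_pM (ltW c0_gt0) (W1_ge0 _ Z1) (c0_le 1%N isT) _.
    rewrite W1E (le_trans _ (ln_invB1_le _ _ Z1))// ler_piMl//.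
      by rewrite (le_trans (Z_ge0 t)) ?ln_invB1_ge.
    by rewrite invf_le1 ?ler1n ?ltr0n.
  have S_le : c0 * \sum_(2 <= j < n.+1) phi j t ^+ 2
      <= \sum_(2 <= j < n.+1) k j * phi j t ^+ 2.
    rewrite mulr_sumr ler_sum_nat// => j /andP[j2 jn].
    by rewrite ler_wpM2r ?sqr_ge0 ?c0_le// (ltnW j2) ltnW.
  have R_le : c0 * varrho t ^+ 2 <= k n.+1 * varrho t ^+ 2.
    by rewrite ler_wpM2r ?sqr_ge0 ?c0_le//=.
  (* The quadratic terms of [W] carry a factor one half; these two signs account for the slack. *)
  have := mulr_ge0 (ltW c0_gt0) (sum_ge0 t).
  have := mulr_ge0 (ltW c0_gt0) (sqr_ge0 (varrho t)).
  move: W1_le S_le R_le; lra.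
have W_decay t : 0 <= t -> (forall s, 0 <= s <= t -> Z s < 1) ->
    W t <= W 0 * expR (- (c0 * t)).
  move=> t0 Zlt; apply: (exp_decay _ _ (derive1 W)) => // s s0t.
  have s0 : 0 <= s by case/andP: s0t.
  have [w dWw w_le] := dW s s0 (Zlt s s0t).
  rewrite derive1E (@derive_val _ _ _ _ _ _ _ dWw); split=> //.
  by rewrite (le_trans w_le)// D_le// Zlt.
have W1_leW t : W1 r (phi1 t) (alpha t) (beta t) <= W t.
  rewrite /W -addrA lerDl addr_ge0// mulr_ge0 ?invr_ge0 ?sqr_ge0//.
have Z_cont t : 0 <= t -> {for t, continuous Z}.
  move=> t0.
  have [m mE] : exists m, (2 * r)%N = m.+2.
    by exists (2 * r).-2; rewrite mulnC muln2 -(prednK r0).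
  have em : ~~ odd m by move: even2r; rewrite mE/= negbK.
  have := is_derive_zetaX _ m _ _ _ t _ _ _ em (lt0r_neq0 (al_gt0 t t0))
    (lt0r_neq0 (be_gt0 t t0)) (dphi1 t t0) (dal t t0) (dbe t t0).
  rewrite -mE => -[dZ _]; apply: differentiable_continuous.
  exact/derivable1_diffP.
have Z0 : Z 0 < 1.
  rewrite zetaX_lt1 ?al_gt0 ?be_gt0// /alpha /beta /phi1.
  by case/andP: y0 => ? ?; apply/andP; split; lra.
have Z_lt1 : forall t, 0 <= t -> Z t < 1.
  have W0_ge0 : 0 <= W 0 by apply: le_trans (W1_ge0 _ Z0) (W1_leW 0).
  (* Before any exit, [W1 <= W t <= W 0] gives [ln (1 - Z t)^-1 <= 2 * r * W 0]; solving for [Z t]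
     yields this [q]. *)
  apply: (@barrier_invariance _ Z (1 - expR (- ((2 * r)%:R * W 0)))) => //.
    by rewrite ltrBlDr ltrDl expR_gt0.
  move=> t t0 Zlt.
  have Zt : Z t < 1 by apply: Zlt; rewrite t0/=.
  have Zp : 0 < 1 - Z t by rewrite subr_gt0.
  rewrite lerBrDr addrC -lerBrDr -[leRHS]lnK ?posrE// ler_expR.
  rewrite lerNl -lnV ?posrE// -ler_pdivrMl ?ltr0n// -W1E (le_trans (W1_leW t))//.
  rewrite (le_trans (W_decay t t0 Zlt))// ler_piMr// -expR0 ler_expR oppr_le0.
  by rewrite mulr_ge0// ltW.
have W_le t (t0 : 0 <= t) : W t <= W 0 * expR (- (c0 * t)).
  by apply: W_decay => // s /andP[s0 _]; exact: Z_lt1.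

(* Bound on the derivative and convergence of the errors *)
split; last split; last split.
- move=> t t0; have Zt := Z_lt1 t t0; split; last split.
  + by rewrite -(zetaX_lt1 _ _ _ _ (2 * r)) ?al_gt0 ?be_gt0.
  + by have [w [dWw _] _] := dW t t0 Zt.
  + have [w dWw w_le] := dW t t0 Zt.
    by rewrite derive1E (@derive_val _ _ _ _ _ _ _ dWw).
(* The power of [phi1] is [Z] times that of the active barrier: [Z] is at most [2 * r * W], and
   [ahi + bhi] dominates both barriers. *)
- apply: (cvg0_expX _ _ c0 ((2 * r)%:R * W 0 * (ahi + bhi) ^+ (2 * r)) _ r2_gt0 c0_gt0).
  move=> t t0; have [/andP[al1 al2] /andP[be1 be2]] := ab_bd t t0.
  have d0 : 0 < (if 0 < phi1 t then beta t else alpha t).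
    by case: ifP => _; rewrite ?al_gt0 ?be_gt0.
  rewrite -normrX ger0_norm ?exprn_even_ge0//.
  have -> : phi1 t ^+ (2 * r) =
      Z t * (if 0 < phi1 t then beta t else alpha t) ^+ (2 * r).
    by rewrite /Z zetaE expr_div_n mulfVK// expf_neq0// gt_eqF.
  rewrite -mulrA [_ ^+ _ * expR _]mulrC mulrA; apply: ler_pM => //.
  + exact: exprn_ge0 (ltW d0).
  + rewrite (le_trans (W1_ge _ (Z_lt1 t t0)))// -mulrA ler_pM2l ?ltr0n//.
    exact: le_trans (W1_leW t) (W_le t t0).
  + apply: lerXn2r; rewrite ?nnegrE ?(ltW d0)//; first by lra.
    by case: ifP => _; lra.
(* Every other term of [W] is nonnegative, so [phi i ^+ 2 <= 2 * W]. *)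
- move=> i /andP[i2 ni]; apply: (cvg0_expX _ 2 c0 (2 * W 0) _ isT c0_gt0) => t t0.
  rewrite -normrX ger0_norm ?sqr_ge0// -mulrA -ler_pdivrMl//.
  apply: le_trans (W_le t t0).
  rewrite /W (bigD1_seq i) ?mem_index_iota ?iota_uniq ?i2//=.
  have := W1_ge0 t (Z_lt1 t t0); have := sqr_ge0 (varrho t).
  have : 0 <= \sum_(2 <= j < n.+1 | j != i) phi j t ^+ 2.
    by rewrite sumr_ge0// => j _; exact: sqr_ge0.
  lra.
- apply: (cvg0_expX _ 2 c0 (2 * W 0) _ isT c0_gt0) => t t0.
  rewrite -normrX ger0_norm ?sqr_ge0// -mulrA -ler_pdivrMl//.
  apply: le_trans (W_le t t0).
  have := W1_ge0 t (Z_lt1 t t0); have := sum_ge0 t.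
  rewrite /W; lra.
Qed.
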